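(* For every three-qubit state $\rho_{ABC}$, $$S^{\max}_{total}(\rho_{ABC})+\tau(\rho_{ABC})\le 3,$$ where $S^{\max}_{total}(\rho_{ABC})=\max\{S_{AB}+S_{AC},\,S_{AB}+S_{BC},\,S_{AC}+S_{BC}\}$.
   Context: For a two-qubit state $\rho$ let $t_{kl}=\mathrm{Tr}[\rho\,\sigma_k\otimes\sigma_l]$ ($\sigma_k$ Pauli matrices) and $S(\rho)=\sum_{k,l=1}^3 t_{kl}^2$; $S_{ij}=S(\rho_{ij})$ for the two-qubit reduced states $\rho_{ij}$ of $\rho_{ABC}$. $\tau$ is the three-tangle: for a pure state, $\tau=1-|\vec a|^2-\mathcal C_{AB}^2-\mathcal C_{AC}^2$, where $\vec a$ with $a_k=\mathrm{Tr}[\rho_A\sigma_k]$ is the Bloch vector of qubit $A$ and $\mathcal C_{ij}$ is the Wootters concurrence of $\rho_{ij}$ ($\mathcal C(\rho)=\max\{0,\lambda_1-\lambda_2-\lambda_3-\lambda_4\}$, $\lambda_i$ the decreasingly ordered square roots of the eigenvalues of $\rho(\sigma_2\otimes\sigma_2)\rho^*(\sigma_2\otimes\sigma_2)$); for a mixed state $\tau$ is the convex roof, i.e. the minimum of $\sum_n p_n\tau(\psi_n)$ over pure-state decompositions $\rho=\sum_n p_n|\psi_n\rangle\langle\psi_n|$. *)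

(* Defs.v *)
From HB Require Import structures.
From mathcomp Require Import all_boot all_order all_algebra.
From mathcomp.real_closed Require Import complex mxtens.
From mathcomp Require Import classical_sets reals.

Set Implicit Arguments.
Unset Strict Implicit.
Unset Printing Implicit Defensive.

Import Order.TTheory GRing.Theory Num.Theory.
Local Open Scope ring_scope.

Section Qubits.
Variable R : realType.
Local Notation C := (R[i]).

Definition adj {m n} (A : 'M[C]_(m, n)) : 'M[C]_(n, m) := (map_mx Num.conj A)^T.

Definition is_state {n} (rho : 'M[C]_n) : Prop :=
  [/\ adj rho = rho,
      (forall v : 'cV[C]_n, 0 <= (adj v *m rho *m v) 0 0) &
      \tr rho = 1].

(* Pauli matrices sigma_1, sigma_2, sigma_3, indexed by k : 'I_3
   (k = 0, 1, 2 stand for sigma_1, sigma_2, sigma_3). *)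
Definition pauli (k : 'I_3) : 'M[C]_2 :=
  \matrix_(i < 2, j < 2)
    match val k with
    | 0 => if i == j then 0 else 1
    | 1 => if i == j then 0
           else if val i == 0 then Complex 0 (-1) else Complex 0 1
    | _ => if i == j then (if val i == 0 then 1 else -1) else 0
    end.

(* t_{kl} = Tr[rho sigma_k (x) sigma_l]  (real for Hermitian rho) *)
Definition tcorr (rho : 'M[C]_(2 * 2)) (k l : 'I_3) : R :=
  complex.Re (\tr (rho *m (pauli k *t pauli l))).

Definition Sval (rho : 'M[C]_(2 * 2)) : R :=
  \sum_(k < 3) \sum_(l < 3) (tcorr rho k l) ^+ 2.

Definition idx3 (a b c : 'I_2) : 'I_(2 * 2 * 2) :=
  mxtens_index (mxtens_index (a, b), c).

Definition rhoAB (rho : 'M[C]_(2 * 2 * 2)) : 'M[C]_(2 * 2) :=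
  \matrix_(i, j) \sum_(c < 2) rho (mxtens_index (i, c)) (mxtens_index (j, c)).

Definition rhoAC (rho : 'M[C]_(2 * 2 * 2)) : 'M[C]_(2 * 2) :=
  \matrix_(i, j) \sum_(b < 2)
     rho (idx3 (mxtens_unindex i).1 b (mxtens_unindex i).2)
         (idx3 (mxtens_unindex j).1 b (mxtens_unindex j).2).

Definition rhoBC (rho : 'M[C]_(2 * 2 * 2)) : 'M[C]_(2 * 2) :=
  \matrix_(i, j) \sum_(a < 2)
     rho (idx3 a (mxtens_unindex i).1 (mxtens_unindex i).2)
         (idx3 a (mxtens_unindex j).1 (mxtens_unindex j).2).

Definition rhoA (rho : 'M[C]_(2 * 2 * 2)) : 'M[C]_2 :=
  \matrix_(i, j) \sum_(b < 2) \sum_(c < 2) rho (idx3 i b c) (idx3 j b c).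

Definition eigvals {n} (M : 'M[C]_n) : seq C :=
  sval (closed_field_poly_normal (char_poly M)).

(* Wootters concurrence: lambda_i = decreasingly ordered square roots of the
   eigenvalues of rho (s2 (x) s2) rho^* (s2 (x) s2); these eigenvalues are
   nonnegative reals, we take the square root of their real part. *)
Definition concurrence (rho : 'M[C]_(2 * 2)) : R :=
  let yy := pauli 1 *t pauli 1 in
  let M := rho *m (yy *m map_mx Num.conj rho *m yy) in
  let lam := sort (fun x y : R => y <= x)
                  [seq Num.sqrt (complex.Re z) | z <- eigvals M] in
  Num.max 0 (lam`_0 - lam`_1 - lam`_2 - lam`_3).

Definition blochA (rho : 'M[C]_(2 * 2 * 2)) (k : 'I_3) : R :=
  complex.Re (\tr (rhoA rho *m pauli k)).

Definition is_unit_vec (psi : 'cV[C]_(2 * 2 * 2)) : Prop :=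
  (adj psi *m psi) 0 0 = 1.

Definition proj (psi : 'cV[C]_(2 * 2 * 2)) : 'M[C]_(2 * 2 * 2) :=
  psi *m adj psi.

Definition tau_pure (psi : 'cV[C]_(2 * 2 * 2)) : R :=
  let rho := proj psi in
  1 - \sum_(k < 3) (blochA rho k) ^+ 2
    - (concurrence (rhoAB rho)) ^+ 2 - (concurrence (rhoAC rho)) ^+ 2.

Definition tau (rho : 'M[C]_(2 * 2 * 2)) : R :=
  inf [set x : R | exists (N : nat) (p : 'I_N -> R)
                          (psi : 'I_N -> 'cV[C]_(2 * 2 * 2)),
         [/\ (forall n, 0 <= p n), \sum_(n < N) p n = 1,
             (forall n, is_unit_vec (psi n)),
             rho = \sum_(n < N) (Complex (p n) 0) *: proj (psi n) &
             x = \sum_(n < N) p n * tau_pure (psi n)]].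

Definition S_total_max (rho : 'M[C]_(2 * 2 * 2)) : R :=
  let SAB := Sval (rhoAB rho) in
  let SAC := Sval (rhoAC rho) in
  let SBC := Sval (rhoBC rho) in
  Num.max (SAB + SAC) (Num.max (SAB + SBC) (SAC + SBC)).

End Qubits.

(* Main.v *)
Require Import Defs.
From HB Require Import structures.
From mathcomp Require Import all_boot all_order all_algebra.
From mathcomp.real_closed Require Import complex mxtens.
From mathcomp Require Import classical_sets reals.
From mathcomp Require Import ring lra.

Set Implicit Arguments.
Unset Strict Implicit.
Unset Printing Implicit Defensive.

Import Order.TTheory GRing.Theory Num.Theory.
Import ComplexField.Normc.
Local Open Scope sesquilinear_scope.
Local Open Scope ring_scope.

(* For a pure state with amplitudes [f a b c], put T = V^T (s2 (x) s2) V, where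
   V is the 4 x 2 matrix whose columns are the slices of [f] along the third
   qubit; T is symmetric.  The nonzero eigenvalues in Wootters' formula are those
   of T^* T, so C_AB^2 = t_AB - 2 d with t_AB the squared Frobenius norm of T and
   d = |det T|, which is the modulus of Cayley's hyperdeterminant and hence the
   same for the three pairs of qubits.  Polynomial identities give
   |a|^2 + t_AB + t_AC = 1 and S_AB = |c|^2 + 2 t_AB, whence tau = 4 d,
   S_AB + S_AC + S_BC = 3, and each S_ij is at least 2 t_ij >= 4 d = tau.
   For a mixed state, S is convex and the spectral decomposition is one of the
   decompositions in the convex roof. *)

(** * Roots of polynomials, characteristic polynomials and finite sums *)

(** A root of one product is a root of the other, so a common linear factor cancels and induction
    applies. *)
Lemma perm_prod_XsubC (F : idomainType) (s t : seq F) :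
  \prod_(z <- s) ('X - z%:P) = \prod_(z <- t) ('X - z%:P) -> perm_eq s t.
Proof.
elim: s t => [|x s IH] t Est.
  by move/(congr1 (size \o polyseq)): Est; rewrite /= !size_prod_XsubC; case: t.
have xt : x \in t by rewrite -root_prod_XsubC -Est root_prod_XsubC mem_head.
rewrite (permPr (perm_to_rem xt)) perm_cons; apply: IH.
move: Est; rewrite (perm_big _ (perm_to_rem xt)) /= !big_cons.
by apply: mulfI; rewrite polyXsubC_eq0.
Qed.

Lemma det_mx22 (K : comPzRingType) (A : 'M[K]_2) :
  \det A = A 0 0 * A 1 1 - A 0 1 * A 1 0.
Proof.
rewrite (expand_det_row _ 0) !big_ord_recl big_ord0 /cofactor !det_mx11 !mxE /=.
rewrite !addr0 expr0 expr1 mul1r mulN1r mulrN.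
have -> : lift ord0 ord0 = 1 :> 'I_2 by exact: val_inj.
have -> // : lift 1 0 = 0 :> 'I_2 by exact: val_inj.
Qed.

(* Both sides equal ['X^n * \det (block_mx 'X%:M A B 1%:M)]: eliminate one or the
   other off-diagonal block. *)
Lemma char_poly_mulmxC (K : idomainType) m n (A : 'M[K]_(m, n)) (B : 'M[K]_(n, m)) :
  'X^n * char_poly (A *m B) = 'X^m * char_poly (B *m A).
Proof.
pose V := map_mx polyC A; pose W := map_mx polyC B.
pose M : 'M[{poly K}]_(m + n) := block_mx 'X%:M V W 1%:M.
have detM : \det M = char_poly (A *m B).
  have -> : M = block_mx ('X%:M - V *m W) V 0 1%:M *m block_mx 1%:M 0 W 1%:M.
    by rewrite mulmx_block !mulmx1 !mulmx0 !mul1mx !add0r subrK.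
  rewrite det_mulmx det_ublock det_lblock !det1 !mulr1.
  by rewrite /char_poly /char_poly_mx map_mxM.
have : \det (block_mx 1%:M 0 (- W) 'X%:M *m M) = 'X^m * char_poly (B *m A).
  rewrite mulmx_block !mul1mx !mul0mx !addr0 !mulmx1 mulNmx.
  rewrite -scalar_mxC addrC subrr det_ublock det_scalar.
  by rewrite /char_poly /char_poly_mx map_mxM mulNmx addrC.
by rewrite det_mulmx det_lblock det1 mul1r det_scalar detM.
Qed.

Lemma char_poly_mx22 (K : comNzRingType) (A : 'M[K]_2) :
  char_poly A = 'X^2 - (\tr A)%:P * 'X + (\det A)%:P.
Proof.
rewrite /char_poly /char_poly_mx !det_mx22 /mxtrace !big_ord_recl big_ord0 !mxE /=.
have -> : lift ord0 ord0 = 1 :> 'I_2 by exact: val_inj.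
rewrite !mulr1n !mulr0n !sub0r addr0 polyCB polyCD !polyCM; ring.
Qed.

Lemma tensmxNN (K : pzRingType) m n p q (A : 'M[K]_(m, n)) (B : 'M[K]_(p, q)) :
  (- A) *t (- B) = A *t B.
Proof. by apply/matrixP => i j; rewrite !mxE mulrNN. Qed.

Lemma sum_mxtens (M : nmodType) m n (F : 'I_(m * n) -> M) :
  \sum_i F i = \sum_(a < m) \sum_(b < n) F (mxtens_index (a, b)).
Proof.
rewrite pair_big /= (reindex (@mxtens_index m n)) /=; last first.
  by exists (@mxtens_unindex m n) => i _; rewrite (mxtens_indexK, mxtens_unindexK).
by apply: eq_bigr => -[].
Qed.

(** The indices come out as [0] and [1] instead of [lift] terms, so that later rewriting with
    concrete amplitudes matches. *)
Lemma sum2 (M : nmodType) (F : 'I_2 -> M) : \sum_i F i = F 0 + F 1.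
Proof. by rewrite !big_ord_recl big_ord0 addr0; congr (_ + F _); apply: val_inj. Qed.

Lemma sum3 (M : nmodType) (F : 'I_3 -> M) : \sum_i F i = F 0 + (F 1 + F 2).
Proof.
rewrite !big_ord_recl big_ord0 addr0.
by congr (_ + (F _ + F _)); apply: val_inj.
Qed.

Lemma mulmx_row_col (K : pzSemiRingType) m n q (A : 'M[K]_(m, n)) (B : 'M[K]_(n, q)) i j :
  (row i A *m col j B) 0 0 = (A *m B) i j.
Proof. by rewrite !mxE; apply: eq_bigr => k _; rewrite !mxE. Qed.

(** * Wootters concurrence of a state of the form [V *m adj V] *)

Section Concurrence.
Variable R : realType.
Local Notation C := (R[i]).
Local Notation yy := (pauli R 1 *t pauli R 1).

(** Real-valued and polynomial in the two parts of [z], which keeps later identities within reach of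
    [ring]. *)
Definition normsq (z : C) : R := complex.Re z ^+ 2 + complex.Im z ^+ 2.

Lemma normsqE (z : C) : (normsq z)%:C%C = Num.conj z * z.
Proof. by rewrite mulrC -normCK -add_Re2_Im2. Qed.

Lemma normsq_normc (z : C) : normsq z = normc z ^+ 2.
Proof. by case: z => a b; rewrite /normsq /= sqr_sqrtr // addr_ge0 // sqr_ge0. Qed.

Lemma normc_ge0 (z : C) : 0 <= normc z.
Proof. by case: z => a b; exact: sqrtr_ge0. Qed.

Lemma pauli1_tr : (pauli R 1)^T = - pauli R 1.
Proof.
apply/matrixP; case=> [[|[]]] // i; case=> [[|[]]] // j.
all: by rewrite !mxE /=; apply/eqP; rewrite eq_complex /= ?opprK ?oppr0 !eqxx.
Qed.

Lemma pauli1_conj : map_mx Num.conj (pauli R 1) = - pauli R 1.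
Proof.
apply/matrixP; case=> [[|[]]] // i; case=> [[|[]]] // j.
all: by rewrite !mxE /=; apply/eqP; rewrite eq_complex /= ?opprK ?oppr0 !eqxx.
Qed.

Lemma yy_conj : map_mx Num.conj yy = yy.
Proof. by rewrite map_mxT pauli1_conj tensmxNN. Qed.

Lemma yy_tr : yy^T = yy.
Proof. by rewrite trmx_tens pauli1_tr tensmxNN. Qed.

Definition spinflip (V : 'M[C]_(2 * 2, 2)) : 'M[C]_2 := V^T *m yy *m V.

Lemma spinflip_tr V : (spinflip V)^T = spinflip V.
Proof. by rewrite /spinflip !trmx_mul trmxK yy_tr mulmxA. Qed.

Definition tangle_trace (V : 'M[C]_(2 * 2, 2)) : R :=
  \sum_(i < 2) \sum_(j < 2) normsq (spinflip V i j).

Definition tangle_det (V : 'M[C]_(2 * 2, 2)) : R := normc (\det (spinflip V)).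

Lemma tangle_det_ge0 V : 0 <= tangle_det V.
Proof. exact: normc_ge0. Qed.

(** For a symmetric matrix with diagonal a, b and off-diagonal entry c, 2|ab - c^2| <= 2|a||b| +
    2|c|^2 <= |a|^2 + |b|^2 + 2|c|^2. *)
Lemma tangle_det_le V : 2 * tangle_det V <= tangle_trace V.
Proof.
rewrite /tangle_det /tangle_trace det_mx22 !big_ord_recl !big_ord0 !addr0.
have -> : lift ord0 ord0 = 1 :> 'I_2 by exact: val_inj.
have -> : ord0 = 0 :> 'I_2 by [].
have E10 : spinflip V 1 0 = spinflip V 0 1 by rewrite -[in LHS](spinflip_tr V) mxE.
rewrite !normsq_normc E10; move: (spinflip V 0 0) (spinflip V 1 1) (spinflip V 0 1).
move=> a b c.
have := le_normcD (a * b) (- (c * c)); rewrite normcN !normcM.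
set na := normc a; set nb := normc b; set nc := normc c => le_n.
have := sqr_ge0 (na - nb); nra.
Qed.

(** Moving the first [V] cyclically to the end turns the 4 x 4 product into the 2 x 2 matrix
    [map_mx Num.conj T *m T], at the cost of two zero eigenvalues. *)
Lemma char_poly_tilde (V : 'M[C]_(2 * 2, 2)) :
  char_poly (V *m adj V *m (yy *m map_mx Num.conj (V *m adj V) *m yy)) =
  'X^2 * ('X^2 - ((tangle_trace V)%:C%C)%:P * 'X
               + ((tangle_det V ^+ 2)%:C%C)%:P).
Proof.
have X2_neq0 : 'X^2 != 0 :> {poly C} by rewrite monic_neq0 ?monicXn.
apply: (mulfI X2_neq0); rewrite -mulmxA char_poly_mulmxC.
set T := spinflip V.
have -> : adj V *m (yy *m map_mx Num.conj (V *m adj V) *m yy) *m V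
       = map_mx Num.conj T *m T.
  rewrite /T /spinflip !map_mxM /= yy_conj /adj !map_trmx -map_mx_comp.
  have -> : map_mx (Num.conj \o Num.conj) V^T = V^T.
    by apply/matrixP => i j; rewrite !mxE /= conjCK.
  by rewrite !mulmxA.
rewrite (_ : 'X^(2 * 2) = 'X^2 * 'X^2); last by rewrite -exprD.
rewrite -mulrA char_poly_mx22 det_mulmx det_map_mx -normsqE -normsq_normc.
congr (_ * (_ * (_ - _%:P * _ + _))).
rewrite /mxtrace /tangle_trace (raddf_sum (real_complex R)) /=.
apply: eq_bigr => i _; rewrite mxE (raddf_sum (real_complex R)) /=.
apply: eq_bigr => j _; have -> : T j i = T i j by rewrite /T -[in LHS]spinflip_tr mxE.
by rewrite mxE normsqE.
Qed.

(** [eigvals] is a chosen list of roots, so only its multiset can be computed. *)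
Lemma eigvals_perm n (A : 'M[C]_n) s :
  char_poly A = \prod_(z <- s) ('X - z%:P) -> perm_eq (eigvals A) s.
Proof.
rewrite /eigvals => EA; case: closed_field_poly_normal => t /=.
rewrite (monicP (char_poly_monic A)) scale1r EA => Est.
by apply: perm_prod_XsubC; rewrite -Est.
Qed.

(** With singular values l1 >= l2 of [spinflip V] the concurrence is l1 - l2, and its square is
    (l1^2 + l2^2) - 2 l1 l2. *)
Lemma concurrence_sqr (V : 'M[C]_(2 * 2, 2)) :
  concurrence (V *m adj V) ^+ 2 = tangle_trace V - 2 * tangle_det V.
Proof.
set t := tangle_trace V; set d := tangle_det V.
have d_ge0 : 0 <= d := tangle_det_ge0 V.
have dt : 2 * d <= t := tangle_det_le V.
(* The singular values of [spinflip V], whose squares sum to [t] and whose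
   product is [d]. *)
pose p := Num.sqrt (t + 2 * d); pose q := Num.sqrt (t - 2 * d).
have p2 : p ^+ 2 = t + 2 * d by rewrite sqr_sqrtr //; lra.
have q2 : q ^+ 2 = t - 2 * d by rewrite sqr_sqrtr //; lra.
have q_ge0 : 0 <= q by exact: sqrtr_ge0.
have qp : q <= p by rewrite ler_sqrt; lra.
pose l1 := (p + q) / 2; pose l2 := (p - q) / 2.
have l2_ge0 : 0 <= l2 by rewrite /l2; lra.
have l21 : l2 <= l1 by rewrite /l1 /l2; lra.
have l1_ge0 : 0 <= l1 := le_trans l2_ge0 l21.
have Et : t = l1 ^+ 2 + l2 ^+ 2 by rewrite /l1 /l2; lra.
have Ed : d = l1 * l2 by rewrite /l1 /l2; lra.
set M := V *m adj V *m (yy *m map_mx Num.conj (V *m adj V) *m yy).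
have eigM : perm_eq (eigvals M)
    [:: (l1 ^+ 2)%:C%C; (l2 ^+ 2)%:C%C; 0; 0].
  (* The quadratic factor splits as (X - l1^2)(X - l2^2). *)
  apply: eigvals_perm; rewrite char_poly_tilde -/t -/d.
  rewrite !big_cons big_nil !polyC0 Ed Et.
  have -> : (l1 ^+ 2 + l2 ^+ 2)%:C%C = (l1 ^+ 2)%:C%C + (l2 ^+ 2)%:C%C.
    exact: (rmorphD (real_complex R)).
  have -> : ((l1 * l2) ^+ 2)%:C%C = (l1 ^+ 2)%:C%C * (l2 ^+ 2)%:C%C.
    by rewrite exprMn; exact: (rmorphM (real_complex R)).
  rewrite polyCD polyCM; ring.
have sortM : sort (fun x y : R => y <= x)
    [seq Num.sqrt (complex.Re z) | z <- eigvals M] = [:: l1; l2; 0; 0].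
  apply: (sorted_eq (leT := fun x y : R => y <= x)).
  - by move=> x y z xy yz; exact: le_trans yz xy.
  - by move=> x y /andP[xy yx]; apply: le_anti; rewrite xy yx.
  - by apply: sort_sorted => x y; exact: le_total.
  - by rewrite /= l21 l2_ge0 lexx.
  rewrite perm_sort (permPl (perm_map _ eigM)) /=.
  by rewrite !sqrtr_sqr !ger0_norm // sqrtr0.
(* In the branch where the maximum is 0, [l1 <= l2] forces [l1 = l2], and both sides vanish. *)
rewrite /concurrence -/M sortM /= !subr0 /Num.max; case: ltrP => l12.
  by rewrite -q2 /l1 /l2; field.
have -> : t - 2 * d = (l1 - l2) ^+ 2 by rewrite Et Ed; ring.
by have -> : l1 - l2 = 0 by apply: le_anti; rewrite l12 subr_ge0.
Qed.

End Concurrence.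

(** * Correlations and Bloch vectors as polynomials in the amplitudes *)

Section PureState.
Variable R : realType.
Local Notation C := (R[i]).

Lemma ReM (x y : C) :
  complex.Re (x * y) = complex.Re x * complex.Re y - complex.Im x * complex.Im y.
Proof. by case: x y => [a b] [c d]. Qed.

Lemma ImM (x y : C) :
  complex.Im (x * y) = complex.Re x * complex.Im y + complex.Im x * complex.Re y.
Proof. by case: x y => [a b] [c d]. Qed.

Lemma ReD (x y : C) : complex.Re (x + y) = complex.Re x + complex.Re y.
Proof. by case: x y => [a b] [c d]. Qed.

Lemma ImD (x y : C) : complex.Im (x + y) = complex.Im x + complex.Im y.
Proof. by case: x y => [a b] [c d]. Qed.

Lemma ReN (x : C) : complex.Re (- x) = - complex.Re x.
Proof. by case: x. Qed.

Lemma ImN (x : C) : complex.Im (- x) = - complex.Im x.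
Proof. by case: x. Qed.

Lemma tcorrE (r : 'M[C]_(2 * 2)) k l : tcorr r k l =
  complex.Re (\sum_(a < 2) \sum_(b < 2) \sum_(c < 2) \sum_(d < 2)
     r (mxtens_index (a, b)) (mxtens_index (c, d)) * (pauli R k c a * pauli R l d b)).
Proof.
rewrite /tcorr /mxtrace sum_mxtens; congr complex.Re.
apply: eq_bigr => a _; apply: eq_bigr => b _; rewrite mxE sum_mxtens.
by apply: eq_bigr => c _; apply: eq_bigr => d _; rewrite tensmxE.
Qed.

(* The squared length of the Bloch vector of the third qubit, whose reduced state
   is the Gram matrix of the columns of [V]. *)
Definition bloch_sqr (V : 'M[C]_(2 * 2, 2)) : R :=
  (\sum_i normsq (V i 0) - \sum_i normsq (V i 1)) ^+ 2
  + 4 * normsq (\sum_i V i 0 * Num.conj (V i 1)).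

Lemma bloch_sqr_ge0 V : 0 <= bloch_sqr V.
Proof.
by rewrite addr_ge0 ?sqr_ge0 // mulr_ge0 // addr_ge0 ?sqr_ge0.
Qed.

(** [yy] is antidiagonal with entries -1, 1, 1, -1. *)
Lemma spinflipE (V : 'M[C]_(2 * 2, 2)) i j : spinflip V i j =
  V (mxtens_index (0, 1)) i * V (mxtens_index (1, 0)) j
  + V (mxtens_index (1, 0)) i * V (mxtens_index (0, 1)) j
  - V (mxtens_index (0, 0)) i * V (mxtens_index (1, 1)) j
  - V (mxtens_index (1, 1)) i * V (mxtens_index (0, 0)) j.
Proof.
rewrite /spinflip !mxE !sum_mxtens !sum2 !mxE !sum_mxtens !sum2 !tensmxE !mxE /=.
have ii : Complex 0 1 * Complex 0 1 = -1 :> C by rewrite -expr2 sqr_i.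
have -> : Complex 0 (-1) = - Complex 0 1 :> C.
  by apply/eqP; rewrite eq_complex /= oppr0 !eqxx.
rewrite !mulrNN !mulrN !mulNr ii; ring.
Qed.

(** Each row of a Pauli matrix has one nonzero entry, so only four coefficients survive; a single
    factor sigma_2 (index 1) turns real parts into imaginary ones. Keeping [e] abstract makes the
    expansion small. *)
Lemma sum_pauliE (e : 'I_2 -> 'I_2 -> 'I_2 -> 'I_2 -> C) :
  let t k l := complex.Re (\sum_(a < 2) \sum_(b < 2) \sum_(c < 2) \sum_(d < 2)
    e a b c d * (pauli R k c a * pauli R l d b)) in
  [/\ t 0 0 = complex.Re (e 0 0 1 1 + e 1 1 0 0 + e 0 1 1 0 + e 1 0 0 1),
      t 0 1 = complex.Im (e 1 1 0 0 - e 0 0 1 1 + e 0 1 1 0 - e 1 0 0 1),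
      t 0 2 = complex.Re (e 0 0 1 0 + e 1 0 0 0 - e 0 1 1 1 - e 1 1 0 1),
      t 1 0 = complex.Im (e 1 1 0 0 - e 0 0 1 1 - e 0 1 1 0 + e 1 0 0 1) &
   [/\ t 1 1 = complex.Re (e 0 1 1 0 + e 1 0 0 1 - e 0 0 1 1 - e 1 1 0 0),
      t 1 2 = complex.Im (e 1 0 0 0 - e 0 0 1 0 + e 0 1 1 1 - e 1 1 0 1),
      t 2 0 = complex.Re (e 0 0 0 1 + e 0 1 0 0 - e 1 0 1 1 - e 1 1 1 0),
      t 2 1 = complex.Im (e 0 1 0 0 - e 0 0 0 1 + e 1 0 1 1 - e 1 1 1 0) &
      t 2 2 = complex.Re (e 0 0 0 0 - e 0 1 0 1 - e 1 0 1 0 + e 1 1 1 1)]].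
Proof.
move=> t; split; last split; rewrite /t.
all: rewrite !sum2 !mxE /=.
all: rewrite ?(mulr0, mul0r, mulr1, mul1r, addr0, add0r, mulrN1, mulN1r, opprK).
all: rewrite ?(ReD, ReN, ReM, ImD, ImN, ImM) /=.
all: ring.
Qed.

(** The last argument of [f] is the qubit to be traced out; reordering the arguments selects another
    pair. *)
Definition amp (f : 'I_2 -> 'I_2 -> 'I_2 -> C) : 'M[C]_(2 * 2, 2) :=
  \matrix_(i, c) f (mxtens_unindex i).1 (mxtens_unindex i).2 c.

Lemma ampE f a b c : amp f (mxtens_index (a, b)) c = f a b c.
Proof. by rewrite mxE mxtens_indexK. Qed.

Lemma spinflip_amp f i j : spinflip (amp f) i j =
  f 0 1 i * f 1 0 j + f 1 0 i * f 0 1 j - f 0 0 i * f 1 1 j - f 1 1 i * f 0 0 j.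
Proof. by rewrite spinflipE !ampE. Qed.

Lemma tangle_traceE f : tangle_trace (amp f) =
  normsq (2 * (f 0 1 0 * f 1 0 0 - f 0 0 0 * f 1 1 0))
  + 2 * normsq (f 0 1 0 * f 1 0 1 + f 1 0 0 * f 0 1 1
                - f 0 0 0 * f 1 1 1 - f 1 1 0 * f 0 0 1)
  + normsq (2 * (f 0 1 1 * f 1 0 1 - f 0 0 1 * f 1 1 1)).
Proof.
have E00 k : spinflip (amp f) k k = 2 * (f 0 1 k * f 1 0 k - f 0 0 k * f 1 1 k).
  by rewrite spinflip_amp; ring.
have E10 : spinflip (amp f) 1 0 = spinflip (amp f) 0 1.
  by rewrite !spinflip_amp; ring.
rewrite /tangle_trace !sum2 !E00 E10 spinflip_amp; ring.
Qed.

Lemma bloch_sqrE f : bloch_sqr (amp f) =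
  (normsq (f 0 0 0) + normsq (f 0 1 0) + normsq (f 1 0 0) + normsq (f 1 1 0)
   - normsq (f 0 0 1) - normsq (f 0 1 1) - normsq (f 1 0 1) - normsq (f 1 1 1)) ^+ 2
  + 4 * normsq (f 0 0 0 * Num.conj (f 0 0 1) + f 0 1 0 * Num.conj (f 0 1 1)
     + f 1 0 0 * Num.conj (f 1 0 1) + f 1 1 0 * Num.conj (f 1 1 1)).
Proof.
rewrite /bloch_sqr !sum_mxtens !sum2 !ampE.
congr (_ ^+ 2 + 4 * normsq _); ring.
Qed.

Lemma Sval_amp f :
  Sval (amp f *m adj (amp f)) = bloch_sqr (amp f) + 2 * tangle_trace (amp f).
Proof.
pose e a b c d := \sum_k f a b k * Num.conj (f c d k).
have Et k l : tcorr (amp f *m adj (amp f)) k l =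
    complex.Re (\sum_(a < 2) \sum_(b < 2) \sum_(c < 2) \sum_(d < 2)
      e a b c d * (pauli R k c a * pauli R l d b)).
  rewrite tcorrE; congr complex.Re.
  do 4![apply: eq_bigr => ? _]; congr (_ * _).
  by rewrite mxE; apply: eq_bigr => k' _; rewrite !mxE !mxtens_indexK.
rewrite /Sval !sum3 !{}Et; have [-> -> -> -> [-> -> -> -> ->]] := sum_pauliE e.
rewrite tangle_traceE bloch_sqrE /e !sum2.
move: (f 0 0 0) (f 0 0 1) (f 0 1 0) (f 0 1 1) (f 1 0 0) (f 1 0 1) (f 1 1 0) (f 1 1 1).
(* What remains is a quartic polynomial identity in sixteen real variables. *)
move=> [x0 y0] [x1 y1] [x2 y2] [x3 y3] [x4 y4] [x5 y5] [x6 y6] [x7 y7].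
rewrite /normsq /=; ring.
Qed.

End PureState.

(** * Permutations of the qubits, the three-tangle and the bound for pure states *)

Section ThreeTangle.
Variable R : realType.
Local Notation C := (R[i]).
Implicit Type f : 'I_2 -> 'I_2 -> 'I_2 -> C.
Implicit Type psi : 'cV[C]_(2 * 2 * 2).

Lemma tangle_trace_swap12 f :
  tangle_trace (amp (fun a b c => f b a c)) = tangle_trace (amp f).
Proof.
by rewrite !tangle_traceE; congr (normsq _ + 2 * normsq _ + normsq _); ring.
Qed.

(** Together with the exchange of the last two qubits this gives every permutation. *)
Lemma tangle_det_swap12 f :
  tangle_det (amp (fun a b c => f b a c)) = tangle_det (amp f).
Proof. by rewrite /tangle_det !det_mx22 !spinflip_amp; congr normc; ring. Qed.

(* [\det (spinflip (amp f))] is Cayley's hyperdeterminant of [f]. *)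
Lemma tangle_det_swap23 f :
  tangle_det (amp (fun a c b => f a b c)) = tangle_det (amp f).
Proof. by rewrite /tangle_det !det_mx22 !spinflip_amp; congr normc; ring. Qed.

(** Homogeneous form of |a|^2 + t_AB + t_AC = 1: the difference of the right side and |a|^2 is 4 det
    rho_A, which is shared between the pairs AB and AC. *)
Lemma bloch_tangle_trace f :
  bloch_sqr (amp (fun b c a => f a b c)) + tangle_trace (amp f)
    + tangle_trace (amp (fun a c b => f a b c))
  = (\sum_a \sum_b \sum_c normsq (f a b c)) ^+ 2.
Proof.
rewrite bloch_sqrE !tangle_traceE !sum2.
move: (f 0 0 0) (f 0 0 1) (f 0 1 0) (f 0 1 1) (f 1 0 0) (f 1 0 1) (f 1 1 0) (f 1 1 1).
move=> [x0 y0] [x1 y1] [x2 y2] [x3 y3] [x4 y4] [x5 y5] [x6 y6] [x7 y7].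
rewrite /normsq /=; ring.
Qed.

Definition coef (psi : 'cV[C]_(2 * 2 * 2)) a b c : C := psi (idx3 a b c) 0.

Lemma proj_coef psi a b c a' b' c' :
  proj psi (idx3 a b c) (idx3 a' b' c') = coef psi a b c * Num.conj (coef psi a' b' c').
Proof. by rewrite mxE big_ord1 !mxE. Qed.

Lemma mulmx_adj_amp f i j :
  (amp f *m adj (amp f)) i j = \sum_c f (mxtens_unindex i).1 (mxtens_unindex i).2 c
    * Num.conj (f (mxtens_unindex j).1 (mxtens_unindex j).2 c).
Proof. by rewrite mxE; apply: eq_bigr => c _; rewrite !mxE. Qed.

(** Tracing out a qubit sums slice times adjoint slice over that qubit; this is the form that
    [concurrence_sqr] and [Sval_amp] require. *)
Lemma rhoAB_proj psi : rhoAB (proj psi) = amp (coef psi) *m adj (amp (coef psi)).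
Proof.
apply/matrixP => i j; rewrite mulmx_adj_amp mxE; apply: eq_bigr => c _.
case: (mxtens_indexP i) => a b; case: (mxtens_indexP j) => a' b'.
by rewrite !mxtens_indexK proj_coef.
Qed.

Lemma rhoAC_proj psi (g := fun a c b => coef psi a b c) :
  rhoAC (proj psi) = amp g *m adj (amp g).
Proof.
apply/matrixP => i j; rewrite mulmx_adj_amp mxE; apply: eq_bigr => c _.
by rewrite proj_coef.
Qed.

Lemma rhoBC_proj psi (g := fun b c a => coef psi a b c) :
  rhoBC (proj psi) = amp g *m adj (amp g).
Proof.
apply/matrixP => i j; rewrite mulmx_adj_amp mxE; apply: eq_bigr => c _.
by rewrite proj_coef.
Qed.

(** The first two components form a vector of length twice the modulus of the off-diagonal entry of
    rho_A; the third is the difference of its diagonal entries. *)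
Lemma blochA_proj psi :
  \sum_(k < 3) blochA (proj psi) k ^+ 2 = bloch_sqr (amp (fun b c a => coef psi a b c)).
Proof.
pose e a a' := \sum_(b < 2) \sum_(c < 2) coef psi a b c * Num.conj (coef psi a' b c).
have Eb k : blochA (proj psi) k =
    complex.Re (\sum_(a < 2) \sum_(a' < 2) e a a' * pauli R k a' a).
  congr complex.Re; apply: eq_bigr => a _; rewrite mxE; apply: eq_bigr => a' _.
  rewrite mxE; congr (_ * _).
  by do 2![apply: eq_bigr => ? _]; rewrite proj_coef.
rewrite sum3 !{}Eb !sum2 !mxE /= ?(mulr0, mul0r, mulr1, mul1r, addr0, add0r, mulrN1).
rewrite bloch_sqrE /e !sum2.
move: (coef psi 0 0 0) (coef psi 0 0 1) (coef psi 0 1 0) (coef psi 0 1 1).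
move: (coef psi 1 0 0) (coef psi 1 0 1) (coef psi 1 1 0) (coef psi 1 1 1).
move=> [x0 y0] [x1 y1] [x2 y2] [x3 y3] [x4 y4] [x5 y5] [x6 y6] [x7 y7].
rewrite /normsq /=; ring.
Qed.

Lemma sum_normsq_coef psi : is_unit_vec psi ->
  \sum_a \sum_b \sum_c normsq (coef psi a b c) = 1.
Proof.
rewrite /is_unit_vec mxE => E; apply: (@complexI R); rewrite rmorph1 -E.
rewrite !sum_mxtens rmorph_sum; apply: eq_bigr => a _.
rewrite rmorph_sum; apply: eq_bigr => b _; rewrite rmorph_sum.
by apply: eq_bigr => c _; rewrite [LHS]normsqE !mxE.
Qed.

(** Both pairs have the same d, so after |a|^2 + t_AB + t_AC = 1 the terms 2d + 2d remain. *)
Lemma tau_pureE psi : is_unit_vec psi ->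
  tau_pure psi = 4 * tangle_det (amp (coef psi)).
Proof.
move=> /sum_normsq_coef psi1.
pose g a c b := coef psi a b c.
transitivity (1 - bloch_sqr (amp (fun b c a => coef psi a b c))
  - (tangle_trace (amp (coef psi)) - 2 * tangle_det (amp (coef psi)))
  - (tangle_trace (amp g) - 2 * tangle_det (amp g))).
  congr (1 - _ - _ - _); first exact: blochA_proj.
    by rewrite rhoAB_proj; exact: concurrence_sqr.
  by rewrite rhoAC_proj; exact: concurrence_sqr.
rewrite (tangle_det_swap23 (coef psi)).
have := bloch_tangle_trace (coef psi); rewrite psi1 expr1n; lra.
Qed.

Lemma tau_pure_ge0 psi : is_unit_vec psi -> 0 <= tau_pure psi.
Proof. by move=> /tau_pureE ->; rewrite mulr_ge0 // tangle_det_ge0. Qed.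

Lemma S_total_tau_pure psi : is_unit_vec psi ->
  S_total_max (proj psi) + tau_pure psi <= 3.
Proof.
move=> psi1; rewrite tau_pureE // /S_total_max rhoAB_proj rhoAC_proj rhoBC_proj.
rewrite !Sval_amp; have {psi1} := sum_normsq_coef psi1; set f := coef psi => f1.
(* [f], [g] and [h] belong to the pairs AB, AC and BC. *)
pose g a c b := f a b c; pose h b c a := f a b c.
have dg : tangle_det (amp g) = tangle_det (amp f) := tangle_det_swap23 f.
have dh : tangle_det (amp h) = tangle_det (amp f).
  by rewrite -(tangle_det_swap23 h) -(tangle_det_swap12 f).
have HA : bloch_sqr (amp h) + tangle_trace (amp f) + tangle_trace (amp g) = 1.
  by rewrite bloch_tangle_trace f1 expr1n.
(* The same identity with B, and below with C, in the role of A. *)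
have HB : bloch_sqr (amp g) + tangle_trace (amp f) + tangle_trace (amp h) = 1.
  rewrite -(tangle_trace_swap12 f) (bloch_tangle_trace (fun b a c => f a b c)).
  by rewrite exchange_big f1 expr1n.
have HC : bloch_sqr (amp f) + tangle_trace (amp g) + tangle_trace (amp h) = 1.
  rewrite -(tangle_trace_swap12 g) -(tangle_trace_swap12 h).
  rewrite (bloch_tangle_trace (fun c a b => f a b c)) exchange_big /=.
  by under eq_bigr do rewrite exchange_big /=; rewrite f1 expr1n.
have := tangle_det_le (amp f); have := tangle_det_le (amp g).
have := tangle_det_le (amp h).
have := bloch_sqr_ge0 (amp f); have := bloch_sqr_ge0 (amp g).
have := bloch_sqr_ge0 (amp h).
rewrite dg dh -/g -/h; move: HA HB HC.
move: (bloch_sqr (amp f)) (bloch_sqr (amp g)) (bloch_sqr (amp h)).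
move: (tangle_trace (amp f)) (tangle_trace (amp g)) (tangle_trace (amp h)).
move: (tangle_det (amp f)) => d tf tg th bf bg bh *.
(* Each sum of two is 3 minus the omitted S, which is at least 4 d. *)
by rewrite -lerBrDr !ge_max; apply/and3P; split; lra.
Qed.

End ThreeTangle.

(** * Convexity and spectral decomposition for mixed states *)

Section MixedState.
Variable R : realType.
Local Notation C := (R[i]).

Lemma Re_sum I (s : seq I) (F : I -> C) :
  complex.Re (\sum_(i <- s) F i) = \sum_(i <- s) complex.Re (F i).
Proof. by apply: big_morph => // x y; exact: ReD. Qed.

(** The variance of [x] under the weights [p] is nonnegative. *)
Lemma sqr_mean_le N (p x : 'I_N -> R) : (forall n, 0 <= p n) -> \sum_n p n = 1 ->
  (\sum_n p n * x n) ^+ 2 <= \sum_n p n * x n ^+ 2.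
Proof.
move=> p_ge0 p1; set m := \sum_n p n * x n.
have : 0 <= \sum_n p n * (x n - m) ^+ 2.
  by apply: sumr_ge0 => n _; rewrite mulr_ge0 ?sqr_ge0.
have -> : \sum_n p n * (x n - m) ^+ 2 =
    \sum_n p n * x n ^+ 2 - m * 2 * m + \sum_n p n * m ^+ 2.
  rewrite {3}/m mulr_sumr -sumrB -big_split /=; apply: eq_bigr => n _; ring.
rewrite -mulr_suml p1; nra.
Qed.

Lemma tcorr_sum N (p : 'I_N -> R) (r : 'I_N -> 'M[C]_(2 * 2)) k l :
  tcorr (\sum_n Complex (p n) 0 *: r n) k l = \sum_n p n * tcorr (r n) k l.
Proof.
rewrite /tcorr mulmx_suml.
have -> : \tr (\sum_n Complex (p n) 0 *: r n *m (pauli R k *t pauli R l)) =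
    \sum_n \tr (Complex (p n) 0 *: r n *m (pauli R k *t pauli R l)).
  exact: raddf_sum.
rewrite Re_sum; apply: eq_bigr => n _.
by rewrite -scalemxAl mxtraceZ ReM /= mul0r subr0.
Qed.

Lemma Sval_convex N (p : 'I_N -> R) (r : 'I_N -> 'M[C]_(2 * 2)) :
  (forall n, 0 <= p n) -> \sum_n p n = 1 ->
  Sval (\sum_n Complex (p n) 0 *: r n) <= \sum_n p n * Sval (r n).
Proof.
move=> p_ge0 p1; rewrite /Sval.
under [X in _ <= X]eq_bigr do rewrite mulr_sumr.
rewrite [X in _ <= X]exchange_big; apply: ler_sum => k _.
under [X in _ <= X]eq_bigr do rewrite mulr_sumr.
rewrite [X in _ <= X]exchange_big; apply: ler_sum => l _.
by rewrite tcorr_sum sqr_mean_le.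
Qed.

Lemma rhoAB_sum N (c : 'I_N -> C) A :
  rhoAB (\sum_n c n *: A n) = \sum_n c n *: rhoAB (A n).
Proof.
apply/matrixP => i j; rewrite !mxE summxE.
under [RHS]eq_bigr do rewrite !mxE mulr_sumr.
rewrite exchange_big; apply: eq_bigr => x _; rewrite summxE.
by apply: eq_bigr => n _; rewrite mxE.
Qed.

Lemma rhoAC_sum N (c : 'I_N -> C) A :
  rhoAC (\sum_n c n *: A n) = \sum_n c n *: rhoAC (A n).
Proof.
apply/matrixP => i j; rewrite !mxE summxE.
under [RHS]eq_bigr do rewrite !mxE mulr_sumr.
rewrite exchange_big; apply: eq_bigr => x _; rewrite summxE.
by apply: eq_bigr => n _; rewrite mxE.
Qed.

Lemma rhoBC_sum N (c : 'I_N -> C) A :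
  rhoBC (\sum_n c n *: A n) = \sum_n c n *: rhoBC (A n).
Proof.
apply/matrixP => i j; rewrite !mxE summxE.
under [RHS]eq_bigr do rewrite !mxE mulr_sumr.
rewrite exchange_big; apply: eq_bigr => x _; rewrite summxE.
by apply: eq_bigr => n _; rewrite mxE.
Qed.

(** Partial traces are linear, so each sum of two is convex, and so is their maximum. *)
Lemma S_total_max_convex N (p : 'I_N -> R) (A : 'I_N -> 'M[C]_(2 * 2 * 2)) :
  (forall n, 0 <= p n) -> \sum_n p n = 1 ->
  S_total_max (\sum_n Complex (p n) 0 *: A n) <= \sum_n p n * S_total_max (A n).
Proof.
move=> p_ge0 p1; rewrite {1}/S_total_max rhoAB_sum rhoAC_sum rhoBC_sum.
have SAB := Sval_convex (fun n => rhoAB (A n)) p_ge0 p1.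
have SAC := Sval_convex (fun n => rhoAC (A n)) p_ge0 p1.
have SBC := Sval_convex (fun n => rhoBC (A n)) p_ge0 p1.
rewrite !ge_max; apply/and3P; split.
- apply: le_trans (lerD SAB SAC) _; rewrite -big_split /=; apply: ler_sum => n _.
  by rewrite -mulrDr ler_wpM2l // /S_total_max le_max lexx.
- apply: le_trans (lerD SAB SBC) _; rewrite -big_split /=; apply: ler_sum => n _.
  by rewrite -mulrDr ler_wpM2l // /S_total_max !le_max lexx orbT.
- apply: le_trans (lerD SAC SBC) _; rewrite -big_split /=; apply: ler_sum => n _.
  by rewrite -mulrDr ler_wpM2l // /S_total_max !le_max lexx !orbT.
Qed.

Lemma state_spectral n (rho : 'M[C]_n) : is_state rho ->
  exists (p : 'I_n -> R) (psi : 'I_n -> 'cV[C]_n),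
    [/\ (forall k, 0 <= p k), \sum_k p k = 1,
        (forall k, (adj (psi k) *m psi k) 0 0 = 1) &
        rho = \sum_k Complex (p k) 0 *: (psi k *m adj (psi k))].
Proof.
case=> rhoH rho_ge0 rho1.
have : rho \is normalmx.
  by apply/normalmxP; move: rhoH; rewrite /adj map_trmx => ->.
case/orthomx_spectral_subproof => -[P D] /= PU rhoE.
have PP : P *m P^t* = 1%:M by apply/unitarymxP.
move: rhoE; rewrite invmx_unitary // => rhoE.
(* The eigenvectors of [rho], with eigenvalues [D 0 k]. *)
pose psi k := col k (P^t*).
have adj_psi k : adj (psi k) = row k P.
  by apply/matrixP => i j; rewrite !mxE conjCK.
have psi1 k : adj (psi k) *m psi k = 1%:M.
  by apply/matrixP => i j; rewrite !ord1 adj_psi mulmx_row_col PP !mxE !eqxx.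
have rho_sum : rho = \sum_k D 0 k *: (psi k *m adj (psi k)).
  rewrite {1}rhoE; apply/matrixP => i j; rewrite !mxE summxE.
  apply: eq_bigr => k _; rewrite adj_psi mul_mx_diag !mxE big_ord1 !mxE; ring.
(* The quadratic form of [rho] at [psi k] equals [D 0 k]. *)
have D_ge0 k : 0 <= D 0 k.
  have := rho_ge0 (psi k); rewrite adj_psi -row_mul mulmx_row_col rhoE !mulmxA PP.
  by rewrite mul1mx -mulmxA PP mulmx1 mxE eqxx.
have DR k : Complex (complex.Re (D 0 k)) 0 = D 0 k.
  exact: RRe_real (ger0_real (D_ge0 k)).
exists (fun k => complex.Re (D 0 k)), psi; split.
- by move=> k; rewrite -ler0c [X in _ <= X]DR.
- apply: (@complexI R); rewrite rmorph_sum rmorph1 -rho1 rho_sum raddf_sum /=.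
  by apply: eq_bigr => k _; rewrite [LHS]DR mxtraceZ mxtrace_mulC psi1 mxtrace1 mulr1.
- by move=> k; rewrite psi1 mxE.
by rewrite {1}rho_sum; apply: eq_bigr => k _; rewrite DR.
Qed.

End MixedState.

Theorem theorem5 (R : realType) (rho : 'M[R[i]]_(2 * 2 * 2)) :
  is_state rho -> S_total_max rho + tau rho <= 3.
Proof.
case/state_spectral => p [psi [p_ge0 p1 psi1 rhoE]].
have tau_le : tau rho <= \sum_n p n * tau_pure (psi n).
  apply: ge_inf; last by exists (2 * 2 * 2)%N, p, psi.
  (* The infimum lies below each member only if the set is bounded below; 0 serves as a bound. *)
  exists 0 => _ [N [q [phi [q_ge0 _ phi1 _ ->]]]].
  by apply: sumr_ge0 => n _; rewrite mulr_ge0 // tau_pure_ge0.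
have S_le := S_total_max_convex (fun n => proj (psi n)) p_ge0 p1.
rewrite -[X in S_total_max X]rhoE in S_le.
apply: le_trans (lerD S_le tau_le) _; rewrite -big_split /=.
have -> : 3 = \sum_n p n * 3 by rewrite -mulr_suml p1 mul1r.
apply: ler_sum => n _; rewrite -mulrDr ler_wpM2l //.
exact: S_total_tau_pure.
Qed.
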